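(* Let $n\ge 1$. If $a$ is a non-zero vector in $\mathbb{C}_n^\perp\subseteq A_n$, then, as subspaces of $A_{n+1}=A_n\times A_n$, $\operatorname{Ann}(a,i_n a)$ is equal to $$\{ (x,i_n x) : x \in \operatorname{Ann}(a) \} \oplus \{ (y, -i_n y) : y \in \mathbb{H}\langle a,i_n \rangle^\perp \},$$ and $\operatorname{Ann}(a, -i_n a)$ is equal to $$\{ (x,-i_n x) : x \in \operatorname{Ann}(a) \} \oplus \{ (y, i_n y) : y \in \mathbb{H}\langle a,i_n \rangle^\perp \}.$$ In particular, the real dimensions of $\operatorname{Ann}(a,i_n a)$ and of $\operatorname{Ann}(a,-i_n a)$ are both equal to $2^n - 4 + \dim \operatorname{Ann}(a)$.
   Context: The Cayley-Dickson algebras $A_n$ are the finite-dimensional, generally non-associative, real algebras with linear involution $x\mapsto x^*$ defined inductively: $A_0=\mathbb{R}$ with trivial involution, and $A_n = A_{n-1}\times A_{n-1}$ additively, with multiplication $(a,b)(c,d) = (ac - d^* b,\ da + bc^* )$ and involution $(a,b)^* = (a^*,-b)$. Thus $\dim_{\mathbb{R}} A_n = 2^n$. The real part of $x$ is $\operatorname{Re}(x)=(x+x^* )/2\in\mathbb{R}$; the real inner product on $A_n$ is $\langle x,y\rangle=\operatorname{Re}(xy^* )$, and $\perp$ denotes orthogonal complement in $A_n$ with respect to it. For $x\in A_n$, $\operatorname{Ann}(x)=\{y\in A_n : xy=0\}$. For $n\geq 1$, $i_n=(0,1)\in A_n$ and $\mathbb{C}_n$ is the real span of $1$ and $i_n$.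 For non-zero $a\in\mathbb{C}_n^\perp$, $\mathbb{H}\langle a,i_n\rangle$ is the real subalgebra of $A_n$ generated by $a$ and $i_n$; it is isomorphic to the quaternions and is spanned by $1,a,i_n,i_na$. *)

(* Defs.v *)
From HB Require Import structures.
From mathcomp Require Import all_boot all_order all_algebra.
From mathcomp Require Import reals.

Set Implicit Arguments.
Unset Strict Implicit.
Unset Printing Implicit Defensive.

Import Order.TTheory GRing.Theory Num.Theory.
Local Open Scope ring_scope.

(* [CD R n.+1] is convertible to [(CD R n * CD R n)%type], with its
   componentwise vector space structure. *)
Fixpoint CD (R : realType) (n : nat) : vectType R :=
  match n with
  | 0 => R^o
  | m.+1 => (CD R m * CD R m)%type
  end.

Definition cdpair (R : realType) (n : nat) (a b : CD R n) : CD R n.+1 := (a, b).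

Fixpoint cdone (R : realType) (n : nat) : CD R n :=
  match n with
  | 0 => (1 : R)
  | m.+1 => cdpair (cdone R m) 0
  end.

Fixpoint cdconj (R : realType) (n : nat) : CD R n -> CD R n :=
  match n with
  | 0 => fun x => x
  | m.+1 => fun x : CD R m * CD R m => cdpair (cdconj x.1) (- x.2)
  end.

Fixpoint cdmul (R : realType) (n : nat) : CD R n -> CD R n -> CD R n :=
  match n with
  | 0 => fun x y : R => x * y
  | m.+1 => fun x y : CD R m * CD R m =>
      cdpair (cdmul x.1 y.1 - cdmul (cdconj y.2) x.2)
             (cdmul y.2 x.1 + cdmul x.2 (cdconj y.1))
  end.

(* The coefficient of the unit; on the real line [R *: cdone R n] it inverts
   [r |-> r *: cdone R n]. *)
Fixpoint cdcoef (R : realType) (n : nat) : CD R n -> R :=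
  match n with
  | 0 => fun x => x
  | m.+1 => fun x : CD R m * CD R m => cdcoef x.1
  end.

(* By [cdreE] below, [(x + x^* ) / 2] is the real multiple [cdre x] of 1. *)
Definition cdre (R : realType) (n : nat) (x : CD R n) : R :=
  cdcoef (2^-1 *: (x + cdconj x)).

Definition cdinner (R : realType) (n : nat) (x y : CD R n) : R :=
  cdre (cdmul x (cdconj y)).

Definition cdrinner (R : realType) (n : nat) (y x : CD R n) : R^o :=
  cdinner x y.

Definition cdrmul (R : realType) (n : nat) (y x : CD R n) : CD R n :=
  cdmul x y.

(* The vector i_n = (0, 1), for n >= 1; the value at n = 0 is junk. *)
Definition cdi (R : realType) (n : nat) : CD R n :=
  match n with
  | 0 => 0
  | m.+1 => cdpair 0 (cdone R m)
  end.

Definition cdlmul (R : realType) (n : nat) (x : CD R n) : 'End(CD R n) :=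
  linfun (cdmul x).

Definition Ann (R : realType) (n : nat) (x : CD R n) : {vspace CD R n} :=
  lker (cdlmul x).

Definition cdcomplex (R : realType) (n : nat) : {vspace CD R n} :=
  <<[:: cdone R n; cdi R n]>>%VS.

(* The orthogonal complement of [U] for [cdinner]; see [memv_cdorth]. *)
Definition cdorth (R : realType) (n : nat) (U : {vspace CD R n}) :
    {vspace CD R n} :=
  (\bigcap_(i < \dim U)
     lker (linfun (cdrinner (vbasis U)`_i)))%VS.

Definition cdprodv (R : realType) (n : nat) (U V : {vspace CD R n}) :
    {vspace CD R n} :=
  <<[seq cdmul u v | u <- vbasis U, v <- vbasis V]>>%VS.

(* The (unital) real subalgebra generated by [S]: as the dimension is finite,
   the increasing chain U, U + UU, ... starting from the span of 1 and [S] is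
   constant from index [\dim {:CD R n}] on.  Lemmas [cdgen_sub], [cdgen_one],
   [cdgen_mul] and [cdgen_min] say that it is the least subalgebra
   containing [S]. *)
Definition cdgen (R : realType) (n : nat) (S : seq (CD R n)) :
    {vspace CD R n} :=
  iter (\dim {: CD R n}) (fun U => U + cdprodv U U)%VS <<cdone R n :: S>>%VS.

Definition cdH (R : realType) (n : nat) (a : CD R n) : {vspace CD R n} :=
  cdgen [:: a; cdi R n].

Definition cdgraph (R : realType) (n : nat) (f : 'End(CD R n)) (x : CD R n) :
    CD R n.+1 :=
  cdpair x (f x).

(* The subspace {(x, f x) : x \in U} of A_{n+1}; see [memv_graphv]. *)
Definition graphv (R : realType) (n : nat) (f : 'End(CD R n))
    (U : {vspace CD R n}) : {vspace CD R n.+1} :=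
  (linfun (cdgraph f) @: U)%VS.

Section Theory.
Variable R : realType.

Lemma dim_CD n : \dim {: CD R n} = (2 ^ n)%N.
Proof.
rewrite dimvf; elim: n => [|n IHn]; first by rewrite expn0.
by rewrite expnS mul2n -addnn -{1}IHn -IHn.
Qed.

Lemma cdconj_is_linear n : linear (@cdconj R n).
Proof.
elim: n => [//|n IHn] k [x1 x2] [y1 y2].
congr pair => /=; first exact: IHn.
by rewrite opprD scalerN.
Qed.
HB.instance Definition _ n :=
  GRing.isLinear.Build R (CD R n) (CD R n) _ (@cdconj R n) (@cdconj_is_linear n).

Lemma cdcoef_is_linear n : linear (@cdcoef R n : CD R n -> R^o).
Proof. by elim: n => [//|n IHn] k [x1 x2] [y1 y2]; apply: IHn. Qed.
HB.instance Definition _ n :=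
  GRing.isLinear.Build R (CD R n) R^o _ (@cdcoef R n) (@cdcoef_is_linear n).

Lemma cdmul_is_bilinear n :
  (forall x : CD R n, linear (cdmul x)) /\
  (forall y : CD R n, linear (fun x : CD R n => cdmul x y)).
Proof.
elim: n => [|n [IHr IHl]].
  split=> x k y z; rewrite /= /GRing.scale /=; first by rewrite mulrDr mulrCA.
  by rewrite mulrDl mulrA.
have cdmulE (x1 x2 y1 y2 : CD R n) :
  cdmul (cdpair x1 x2) (cdpair y1 y2) =
    cdpair (cdmul x1 y1 - cdmul (cdconj y2) x2)
           (cdmul y2 x1 + cdmul x2 (cdconj y1)) by [].
have linE k (y1 y2 z1 z2 : CD R n) :
  k *: cdpair y1 y2 + cdpair z1 z2 = cdpair (k *: y1 + z1) (k *: y2 + z2).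
  by [].
split=> -[x1 x2] k [y1 y2] [z1 z2]; rewrite -![(_, _)]/(cdpair _ _).
  all: rewrite linE !cdmulE linE; congr cdpair.
- by rewrite IHr linearP IHl scalerBr opprD addrACA.
- by rewrite IHl linearP IHr scalerDr addrACA.
- by rewrite IHl IHr scalerBr opprD addrACA.
- by rewrite IHl IHr scalerDr addrACA.
Qed.

Lemma cdmul_is_linear n (x : CD R n) : linear (cdmul x).
Proof. exact: (cdmul_is_bilinear n).1. Qed.
HB.instance Definition _ n (x : CD R n) :=
  GRing.isLinear.Build R (CD R n) (CD R n) _ (cdmul x) (cdmul_is_linear x).

Lemma cdrmul_is_linear n (y : CD R n) : linear (cdrmul y).
Proof. exact: (cdmul_is_bilinear n).2. Qed.
HB.instance Definition _ n (y : CD R n) :=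
  GRing.isLinear.Build R (CD R n) (CD R n) _ (cdrmul y) (cdrmul_is_linear y).

Lemma cdreE n (x : CD R n) : cdre x *: cdone R n = 2^-1 *: (x + cdconj x).
Proof.
rewrite /cdre; elim: n x => [|n IHn] x; first by rewrite /= /GRing.scale /= mulr1.
case: x => x1 x2; congr pair => /=; first exact: IHn.
by rewrite scaler0 subrr scaler0.
Qed.

Lemma cdre_is_linear n : linear (@cdre R n : CD R n -> R^o).
Proof.
move=> k x y; rewrite /cdre -linearP; congr cdcoef.
by rewrite linearP addrACA -scalerDr [LHS]scalerDr !scalerA mulrC.
Qed.
HB.instance Definition _ n :=
  GRing.isLinear.Build R (CD R n) R^o _ (@cdre R n) (@cdre_is_linear n).

Lemma cdrinner_is_linear n (y : CD R n) : linear (cdrinner y).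
Proof.
move=> k u v; rewrite /cdrinner /cdinner -![cdmul _ (cdconj y)]/(cdrmul _ _).
by rewrite !linearP.
Qed.
HB.instance Definition _ n (y : CD R n) :=
  GRing.isLinear.Build R (CD R n) R^o _ (cdrinner y) (cdrinner_is_linear y).

Lemma cdinnerr_is_linear n (x : CD R n) : linear (cdinner x : CD R n -> R^o).
Proof. by move=> k u v; rewrite /cdinner !linearP. Qed.
HB.instance Definition _ n (x : CD R n) :=
  GRing.isLinear.Build R (CD R n) R^o _ (cdinner x) (cdinnerr_is_linear x).

Lemma cdlmulE n (x y : CD R n) : cdlmul x y = cdmul x y.
Proof. by rewrite lfunE. Qed.

Lemma memv_Ann n (x y : CD R n) : (y \in Ann x) = (cdmul x y == 0).
Proof. by rewrite memv_ker cdlmulE. Qed.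

Lemma memv_cdorth n (U : {vspace CD R n}) (x : CD R n) :
  reflect (forall u, u \in U -> cdinner x u = 0) (x \in cdorth U).
Proof.
apply: (iffP idP) => [/subv_bigcapP xU u /coord_vbasis -> | xU].
  rewrite linear_sum big1 // => i _; rewrite linearZ /=.
  by have:= xU i isT; rewrite -memvE memv_ker lfunE /= /cdrinner => /eqP ->; rewrite scaler0.
apply/subv_bigcapP => i _; rewrite -memvE memv_ker lfunE /= /cdrinner xU //.
by rewrite vbasis_mem ?mem_nth ?size_tuple.
Qed.

Lemma cdprodvP n (U V W : {vspace CD R n}) :
  reflect (forall u v, u \in U -> v \in V -> cdmul u v \in W)
          (cdprodv U V <= W)%VS.
Proof.
apply: (iffP span_subvP) => [sUVW u v Uu /coord_vbasis -> | sUVW].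
  rewrite linear_sum; apply: memv_suml => j _; rewrite linearZ memvZ //=.
  rewrite (coord_vbasis Uu).
  rewrite -[cdmul _ _]/(cdrmul _ _) linear_sum; apply: memv_suml => i _.
  rewrite linearZ memvZ //; apply: sUVW; apply/allpairsP.
  by exists ((vbasis U)`_i, (vbasis V)`_j); rewrite !mem_nth ?size_tuple.
move=> _ /allpairsP[[u v] /= [Uu Vv ->]].
by rewrite sUVW ?vbasis_mem.
Qed.

Lemma cdgen_base n (S : seq (CD R n)) : (<<cdone R n :: S>> <= cdgen S)%VS.
Proof.
rewrite /cdgen; elim: (\dim _) => [|k IHk] //=.
exact: subv_trans IHk (addvSl _ _).
Qed.

Lemma cdgen_one n (S : seq (CD R n)) : cdone R n \in cdgen S.
Proof. by apply: (subvP (cdgen_base S)); rewrite memv_span ?mem_head. Qed.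

Lemma cdgen_sub n (S : seq (CD R n)) : {subset S <= cdgen S}.
Proof.
by move=> x Sx; apply: (subvP (cdgen_base S)); rewrite memv_span ?inE ?Sx ?orbT.
Qed.

Lemma cdgen_mul n (S : seq (CD R n)) u v :
  u \in cdgen S -> v \in cdgen S -> cdmul u v \in cdgen S.
Proof.
pose F (U : {vspace CD R n}) := (U + cdprodv U U)%VS.
pose G k := iter k F <<cdone R n :: S>>%VS.
have subG k : (G k <= G k.+1)%VS by rewrite /G iterS addvSl.
have stab k : G k.+1 = G k \/ (k < \dim (G k.+1))%N.
  elim: k => [|k [IHk|IHk]].
  - right; apply: leq_trans (dimvS (subG 0%N)); rewrite lt0n dimv_eq0.
    apply/eqP => G0; have : cdone R n \in G 0%N by rewrite memv_span ?mem_head.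
    rewrite G0 memv0 => /eqP /(congr1 (@cdcoef R n)).
    rewrite linear0; suff -> : cdcoef (cdone R n) = 1 by move/eqP; rewrite oner_eq0.
    by elim: (n).
  - by left; rewrite [LHS]iterS -/(G k.+1) IHk.
  - have [eqG|neG] := eqVneq (G k.+2) (G k.+1); first by left.
    right; apply: leq_ltn_trans IHk _.
    by rewrite (ltn_leqif (dimv_leqif_eq (subG k.+1))) eq_sym.
have eqG : G (\dim {: CD R n}).+1 = G (\dim {: CD R n}).
  by have [//|] := stab (\dim {: CD R n}); rewrite ltnNge dimvS ?subvf.
rewrite -[cdgen S]/(G _); move=> Gu Gv; rewrite -eqG [G _]iterS.
by apply: (subvP (addvSr _ _)); apply: (cdprodvP _ _ _ (subvv _)).
Qed.

Lemma cdgen_min n (S : seq (CD R n)) (U : {vspace CD R n}) :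
  cdone R n \in U -> {subset S <= U} ->
  (forall u v, u \in U -> v \in U -> cdmul u v \in U) -> (cdgen S <= U)%VS.
Proof.
move=> U1 SU UU; rewrite /cdgen; elim: (\dim _) => [|k IHk] /=.
  by apply/span_subvP => x; rewrite inE => /predU1P[-> //|/SU].
rewrite subv_add IHk; apply/cdprodvP => u v Uu Uv.
by apply: UU; apply: (subvP IHk).
Qed.

Lemma cdgraph_is_linear n (f : 'End(CD R n)) : linear (cdgraph f).
Proof. by move=> k x y; rewrite /cdgraph linearP. Qed.
HB.instance Definition _ n (f : 'End(CD R n)) :=
  GRing.isLinear.Build R (CD R n) (CD R n.+1) _
    (cdgraph f) (cdgraph_is_linear f).

Lemma memv_graphv n (f : 'End(CD R n)) (U : {vspace CD R n}) z :
  reflect (exists2 x, x \in U & z = cdpair x (f x)) (z \in graphv f U).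
Proof.
by apply: (iffP memv_imgP) => -[x Ux ->]; exists x; rewrite ?lfunE.
Qed.

End Theory.

(* Main.v *)
From HB Require Import structures.
Require Import Defs.
From mathcomp Require Import all_boot all_order all_algebra.
From mathcomp Require Import reals.
From mathcomp Require Import lra.

Set Implicit Arguments.
Unset Strict Implicit.
Unset Printing Implicit Defensive.

Import Order.TTheory GRing.Theory Num.Theory.
Local Open Scope ring_scope.

(** Write [i] for [i_n], [alpha] for [(a, i a)] and [H] for the quaternion
    algebra spanned by [1, a, i, i a].

    Although the algebras are not associative, [Re ((x y) z) = Re (x (y z))]
    ([cdre_mulA]), so left multiplication by [x] has adjoint left
    multiplication by [x^*] ([cdinner_mull]).  Hence if [x^* = - x] then
    [Ann x] is orthogonal to the image of left multiplication by [x]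
    ([Ann_imag_orth]).  By the multiplication table of [H], left
    multiplication by [a] maps [H] onto itself, and left multiplication by
    [alpha] maps [H * H] onto itself.  So [Ann a] lies in the orthogonal
    complement of [H] ([Ann_sub_cdH_orth]), and both components of every
    element of [Ann alpha] lie there too ([Ann_pair_i_orth]).

    The failure of associativity is mild when [i] is one of the factors: for
    [a] and [u] orthogonal to [1] and [i] we have [(i a) u = (a u) i]
    ([cdi_mulA]).  If [u] is orthogonal to all of [H], then so is [a u], which
    therefore anticommutes with [i], and this gives ([cdmul_pair_i_graph])
    << alpha (u, i u) = 2 (a u, i (a u))   and   alpha (u, - i u) = 0. >>
    Since [i (i y) = - y], every pair of elements of the orthogonal complement
    of [H] is uniquely [(u, i u) + (v, - i v)] with [u] and [v] in that
    complement, and [alpha] kills it exactly when [a u = 0].  This is the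
    first equality of subspaces.

    The second equality is the image of the first one under the algebra
    automorphism [(x, y) |-> (x, - y)] ([cdflipM]).  The sums are direct
    because [i x = - i x] forces [x = 0], and the dimensions follow since [H]
    has dimension 4. *)

Section CayleyDickson.
Variable R : realType.

(** * Multiplication, conjugation and the inner product *)

(** Case analysis that keeps the two halves in [CD R n] and the pair folded. *)
Lemma cdpairP n (P : CD R n.+1 -> Prop) :
  (forall x1 x2 : CD R n, P (cdpair x1 x2)) -> forall x, P x.
Proof. by move=> Ppair [x1 x2]; apply: Ppair. Qed.

Lemma cdmul_pair n (x1 x2 y1 y2 : CD R n) :
  cdmul (cdpair x1 x2) (cdpair y1 y2) =
    cdpair (cdmul x1 y1 - cdmul (cdconj y2) x2)
           (cdmul y2 x1 + cdmul x2 (cdconj y1)).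
Proof. by []. Qed.

Lemma cdconj_pair n (x1 x2 : CD R n) :
  cdconj (cdpair x1 x2) = cdpair (cdconj x1) (- x2).
Proof. by []. Qed.

Lemma cdpairN n (x1 x2 : CD R n) : - cdpair x1 x2 = cdpair (- x1) (- x2).
Proof. by []. Qed.

Lemma cdpairD n (x1 x2 y1 y2 : CD R n) :
  cdpair x1 x2 + cdpair y1 y2 = cdpair (x1 + y1) (x2 + y2).
Proof. by []. Qed.

Lemma cdmul0l n (y : CD R n) : cdmul 0 y = 0.
Proof. exact: linear0 (cdrmul y). Qed.

Lemma cdmulNl n (x y : CD R n) : cdmul (- x) y = - cdmul x y.
Proof. exact: (linearN (cdrmul y)). Qed.

Lemma cdmulDl n (x y z : CD R n) : cdmul (x + y) z = cdmul x z + cdmul y z.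
Proof. exact: (linearD (cdrmul z)). Qed.

Lemma cdmulZl n k (x y : CD R n) : cdmul (k *: x) y = k *: cdmul x y.
Proof. exact: (linearZ_LR (cdrmul y)). Qed.

Lemma cdmul0r n (x : CD R n) : cdmul x 0 = 0.
Proof. exact: linear0. Qed.

Lemma cdmulNr n (x y : CD R n) : cdmul x (- y) = - cdmul x y.
Proof. exact: linearN. Qed.

Lemma cdmulZr n k (x y : CD R n) : cdmul x (k *: y) = k *: cdmul x y.
Proof. exact: linearZ. Qed.

Lemma cdconjN n (x : CD R n) : cdconj (- x) = - cdconj x.
Proof. exact: linearN. Qed.

Lemma cdinnerNr n (x y : CD R n) : cdinner x (- y) = - cdinner x y.
Proof. exact: linearN. Qed.

Lemma cdinnerZr n k (x y : CD R n) : cdinner x (k *: y) = k * cdinner x y.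
Proof. exact: linearZ. Qed.

Lemma cdconjK n : involutive (@cdconj R n).
Proof. by elim: n => [//|n IHn] [x1 x2]; rewrite /= /cdpair IHn opprK. Qed.

Lemma cdconj1 n : cdconj (cdone R n) = cdone R n.
Proof. by elim: n => [//|n IHn] /=; rewrite IHn oppr0. Qed.

(** The two sides are proved together, as each unit law of [CD R n.+1] uses both
    unit laws of [CD R n]. *)
Lemma cdmul1 n (x : CD R n) :
  cdmul (cdone R n) x = x /\ cdmul x (cdone R n) = x.
Proof.
elim: n x => [|n IHn] x; first by split; [apply: mul1r | apply: mulr1].
have IHl y := (IHn y).1; have IHr y := (IHn y).2.
elim/cdpairP: x => x1 x2.
rewrite ![cdone _ _]/(cdpair (cdone R n) 0) !cdmul_pair cdconj1 !linear0.
by rewrite !cdmul0l !IHl !IHr !subr0 add0r !addr0.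
Qed.

Lemma cdmul1l n (x : CD R n) : cdmul (cdone R n) x = x.
Proof. exact: (cdmul1 x).1. Qed.

Lemma cdmul1r n (x : CD R n) : cdmul x (cdone R n) = x.
Proof. exact: (cdmul1 x).2. Qed.

Lemma cdconjM n (x y : CD R n) :
  cdconj (cdmul x y) = cdmul (cdconj y) (cdconj x).
Proof.
elim: n x y => [|n IHn] x y; first exact: mulrC.
elim/cdpairP: x => x1 x2; elim/cdpairP: y => y1 y2.
rewrite cdmul_pair !cdconj_pair cdmul_pair !linearN !linearB /=.
by rewrite !linearN /= !IHn !cdconjK !cdmulNl !opprK opprD
  (addrC (- cdmul y2 x1)).
Qed.

Lemma cdre_conj n (x : CD R n) : cdre (cdconj x) = cdre x.
Proof. by rewrite /cdre cdconjK addrC. Qed.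

Lemma cdre_pair n (x1 x2 : CD R n) : cdre (cdpair x1 x2) = cdre x1.
Proof. by []. Qed.

(** The first component of [(x1, x2) (y1, y2)] is [x1 y1 - y2^* x2]; exchanging
    the factors conjugates the second product, which preserves [Re]. *)
Lemma cdre_mulC n (x y : CD R n) : cdre (cdmul x y) = cdre (cdmul y x).
Proof.
elim: n x y => [|n IHn] x y; first by congr cdre; exact: mulrC.
elim/cdpairP: x => x1 x2; elim/cdpairP: y => y1 y2.
rewrite !cdmul_pair !cdre_pair !linearB /= IHn; congr (_ - _).
by rewrite -cdre_conj cdconjM cdconjK.
Qed.

(** In components each side is a sum of four traces [Re] of triple products of
    elements of [CD R n], and they match up to associativity and cyclic
    permutation.  The associator itself is thus always purely imaginary. *)
Lemma cdre_mulA n (x y z : CD R n) :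
  cdre (cdmul (cdmul x y) z) = cdre (cdmul x (cdmul y z)).
Proof.
elim: n x y z => [|n IHn] x y z; first by congr cdre; rewrite /= mulrA.
elim/cdpairP: x => x1 x2; elim/cdpairP: y => y1 y2.
elim/cdpairP: z => z1 z2.
rewrite !cdmul_pair !cdre_pair !linearD !cdmulDl !cdmulNl !linearN /=.
rewrite !cdconjM !cdconjK linearB linearD /= IHn.
have -> : cdre (cdmul (cdmul (cdconj y2) x2) z1) =
          cdre (cdmul (cdmul z1 (cdconj y2)) x2) by rewrite cdre_mulC IHn.
have -> : cdre (cdmul (cdconj z2) (cdmul y2 x1)) =
          cdre (cdmul x1 (cdmul (cdconj z2) y2)) by rewrite -IHn cdre_mulC.
have -> : cdre (cdmul (cdconj z2) (cdmul x2 (cdconj y1))) =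
          cdre (cdmul (cdmul (cdconj y1) (cdconj z2)) x2).
  by rewrite -IHn cdre_mulC IHn.
lra.
Qed.

Lemma cdinner_pair n (x1 x2 y1 y2 : CD R n) :
  cdinner (cdpair x1 x2) (cdpair y1 y2) = cdinner x1 y1 + cdinner x2 y2.
Proof.
rewrite /cdinner cdconj_pair cdmul_pair cdre_pair linearB /=.
rewrite linearN cdmulNl linearN /= opprK.
by rewrite [cdre (cdmul (cdconj _) _)]cdre_mulC.
Qed.

Lemma cdinnerC n (x y : CD R n) : cdinner x y = cdinner y x.
Proof. by rewrite /cdinner -cdre_conj cdconjM cdconjK. Qed.

Lemma cdinner_mull n (a x y : CD R n) :
  cdinner (cdmul a x) y = cdinner x (cdmul (cdconj a) y).
Proof.
by rewrite /cdinner cdconjM cdconjK cdre_mulA cdre_mulC cdre_mulA.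
Qed.

Lemma cdinner1r n (x : CD R n) : cdinner x (cdone R n) = cdre x.
Proof. by rewrite /cdinner cdconj1 cdmul1r. Qed.

Lemma cdinner0l n (x : CD R n) : cdinner 0 x = 0.
Proof. by rewrite cdinnerC linear0. Qed.

Lemma cdinner_ge0 n (x : CD R n) : 0 <= cdinner x x.
Proof.
elim: n x => [|n IHn] x; last first.
  by elim/cdpairP: x => x1 x2; rewrite cdinner_pair addr_ge0.
rewrite /cdinner /cdre /= /GRing.scale /= mulr_ge0 ?invr_ge0 //.
by rewrite addr_ge0 ?sqr_ge0.
Qed.

Lemma cdinner_eq0 n (x : CD R n) : (cdinner x x == 0) = (x == 0).
Proof.
apply/eqP/eqP => [|->]; last exact: linear0.
elim: n x => [|n IHn] x.
  rewrite /cdinner /cdre /= /GRing.scale /= => /eqP; rewrite mulf_eq0 invr_eq0.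
  by rewrite pnatr_eq0 /= -mulr2n mulrn_eq0 /= mulf_eq0 orbb => /eqP.
elim/cdpairP: x => x1 x2 /eqP; rewrite cdinner_pair paddr_eq0 ?cdinner_ge0 //.
by case/andP => /eqP/IHn -> /eqP/IHn ->.
Qed.

Lemma cdmul_conj n (x : CD R n) :
  cdmul x (cdconj x) = cdinner x x *: cdone R n.
Proof.
rewrite /cdinner cdreE cdconjM cdconjK -mulr2n -scaler_nat scalerA.
by rewrite mulVf ?scale1r ?pnatr_eq0.
Qed.

(** This turns orthogonality to 1 into an equation fit for rewriting. *)
Lemma cdconj_eqN n (x : CD R n) : (cdconj x == - x) = (cdre x == 0).
Proof.
rewrite -addr_eq0 addrC; apply/eqP/eqP => [x0|x0].
  by rewrite /cdre x0 scaler0 linear0.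
have /eqP := cdreE x; rewrite x0 scale0r eq_sym scaler_eq0 invr_eq0.
by rewrite pnatr_eq0 => /eqP.
Qed.

(** * Orthogonal complements *)

Lemma memv_cdorth_span n (s : seq (CD R n)) (x : CD R n) :
  reflect {in s, forall u, cdinner x u = 0} (x \in cdorth <<s>>).
Proof.
apply: (iffP (memv_cdorth _ _)) => [xs u su | xs u]; first exact/xs/memv_span.
have /span_subvP/subvP sK :
    {subset s <= lker (linfun (cdinner x : CD R n -> R^o))}.
  by move=> v sv; rewrite memv_ker lfunE /= xs.
by move/sK; rewrite memv_ker lfunE => /eqP.
Qed.

Lemma cdorthS n (U V : {vspace CD R n}) :
  (U <= V)%VS -> (cdorth V <= cdorth U)%VS.
Proof.
move=> sUV; apply/subvP => x /memv_cdorth xV; apply/memv_cdorth => u Uu.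
exact/xV/(subvP sUV).
Qed.

Lemma capv_cdorth n (U : {vspace CD R n}) : (U :&: cdorth U = 0)%VS.
Proof.
apply/eqP; rewrite -subv0; apply/subvP => x /memv_capP[Ux /memv_cdorth xU].
by rewrite memv0 -cdinner_eq0 xU.
Qed.

(** The complement contains the kernel of a linear map to a space of dimension
    [\dim U], which bounds its dimension from below; it meets [U] trivially,
    which bounds it from above. *)
Lemma dim_cdorth n (U : {vspace CD R n}) :
  (\dim U + \dim (cdorth U))%N = (2 ^ n)%N.
Proof.
pose f (x : CD R n) : 'rV[R]_(\dim U) := \row_j cdinner x (vbasis U)`_j.
have f_lin : linear f.
  move=> k x y; apply/rowP => j; rewrite !mxE.
  exact: (linearP (cdrinner (vbasis U)`_j)).
pose fL := GRing.isLinear.Build R (CD R n) _ _ f f_lin.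
pose F : {linear CD R n -> 'rV[R]_(\dim U)} := HB.pack f fL.
have kerF : (lker (linfun F) <= cdorth U)%VS.
  apply/subvP => x; rewrite memv_ker lfunE => /eqP/rowP Fx.
  rewrite -(span_basis (vbasisP U)); apply/memv_cdorth_span => u /(nthP 0).
  case=> j; rewrite size_tuple => ltj <-.
  by have := Fx (Ordinal ltj); rewrite !mxE.
apply/eqP; rewrite eqn_leq; apply/andP; split.
  rewrite -dimv_disjoint_sum ?capv_cdorth // -(dim_CD R n).
  exact/dimvS/subvf.
rewrite -(dim_CD R n) -(limg_ker_dim (linfun F) fullv) capfv addnC leq_add //.
  rewrite (leq_trans (dimvS (subvf _))) // dimvf.
  by rewrite /dim /= mul1n.
exact: dimvS.
Qed.

Lemma free_cdorthogonal n (s : seq (CD R n)) :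
  0 \notin s -> pairwise (fun x y => cdinner x y == 0) s -> free s.
Proof.
elim: s => [|x s IHs]; first by rewrite nil_free.
rewrite inE negb_or => /andP[x0 s0] /= /andP[xs /IHs fs].
rewrite free_cons fs // andbT; apply/negP => sx.
have : x \in (<<s>> :&: cdorth <<s>>)%VS.
  rewrite memv_cap sx; apply/memv_cdorth_span => u su.
  exact/eqP/(allP xs).
by rewrite capv_cdorth memv0 eq_sym (negPf x0).
Qed.

(** * The unit i_n *)

(* On [CD R n.+1] these fixpoints would reduce to explicit pairs. *)
Local Arguments cdi : simpl never.
Local Arguments cdmul : simpl never.
Local Arguments cdone : simpl never.
Local Arguments cdconj : simpl never.
Local Notation i n := (cdi R n.+1).

Lemma cdi_mull n (x1 x2 : CD R n) :
  cdmul (i n) (cdpair x1 x2) = cdpair (- cdconj x2) (cdconj x1).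
Proof. by rewrite cdmul_pair cdmul0l linear0 cdmul1l cdmul1r sub0r add0r. Qed.

Lemma cdi_mulr n (x1 x2 : CD R n) :
  cdmul (cdpair x1 x2) (i n) = cdpair (- x2) x1.
Proof.
by rewrite cdmul_pair cdconj1 !linear0 !cdmul1l sub0r addr0.
Qed.

Lemma cdconj_i n : cdconj (i n) = - i n.
Proof. by rewrite cdconj_pair linear0 cdpairN oppr0. Qed.

Lemma cdi_mulKl n (x : CD R n.+1) : cdmul (i n) (cdmul (i n) x) = - x.
Proof.
elim/cdpairP: x => x1 x2; rewrite !cdi_mull linearN /=.
by rewrite !cdconjK.
Qed.

Lemma cdii n : cdmul (i n) (i n) = - cdone R n.+1.
Proof. by rewrite -[X in cdmul _ X]cdmul1r cdi_mulKl. Qed.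

Local Notation Cperp n := (cdorth (cdcomplex R n.+1)).

Lemma cdorth_complexP n (x1 x2 : CD R n) :
  reflect (cdconj x1 = - x1 /\ cdconj x2 = - x2) (cdpair x1 x2 \in Cperp n).
Proof.
apply: (iffP (memv_cdorth_span _ _)) => [xC | [/eqP + /eqP +] u].
  have := xC _ (mem_head _ _); have := xC (i n) (mem_last _ [:: _]).
  rewrite !cdinner_pair !linear0 !cdinner1r add0r addr0 => /eqP x2_0 /eqP x1_0.
  by split; apply/eqP; rewrite cdconj_eqN.
rewrite !cdconj_eqN !inE => /eqP x1_0 /eqP x2_0 /orP[]/eqP ->.
  by rewrite cdinner_pair cdinner1r linear0 addr0.
by rewrite cdinner_pair cdinner1r linear0 add0r.
Qed.

Lemma cdconj_perp n (x : CD R n.+1) : x \in Cperp n -> cdconj x = - x.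
Proof.
by elim/cdpairP: x => x1 x2 /cdorth_complexP[x1N _]; rewrite cdconj_pair x1N.
Qed.

Lemma cdi_perp n (x : CD R n.+1) : x \in Cperp n -> cdmul (i n) x \in Cperp n.
Proof.
elim/cdpairP: x => x1 x2 /cdorth_complexP[x1N x2N]; rewrite cdi_mull.
by apply/cdorth_complexP; rewrite x2N x1N !opprK linearN /= x1N x2N opprK.
Qed.

Lemma cdi_anticomm n (x : CD R n.+1) :
  x \in Cperp n -> cdmul x (i n) = - cdmul (i n) x.
Proof.
elim/cdpairP: x => x1 x2 /cdorth_complexP[x1N x2N]; rewrite cdi_mull cdi_mulr.
by rewrite x1N x2N cdpairN !opprK.
Qed.

(** In coordinates, [i a = (a2, - a1)] when [a1] and [a2] are imaginary, and
    both sides are the product [a u] with its two halves exchanged and one sign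
    changed. *)
Lemma cdi_mulA n (a u : CD R n.+1) : a \in Cperp n -> u \in Cperp n ->
  cdmul (cdmul (i n) a) u = cdmul (cdmul a u) (i n).
Proof.
elim/cdpairP: a => a1 a2; elim/cdpairP: u => u1 u2.
move=> /cdorth_complexP[a1N a2N] /cdorth_complexP[u1N u2N].
rewrite cdi_mull [cdmul (cdpair a1 a2) _]cdmul_pair cdi_mulr a1N a2N opprK.
rewrite cdmul_pair u1N u2N !linearN /= !cdmulNl !opprK opprB.
by rewrite [in RHS](addrC (cdmul a1 u1)).
Qed.

(** The conjugate of [cdi_mulA]. *)
Lemma cdi_mulCA n (a u : CD R n.+1) : a \in Cperp n -> u \in Cperp n ->
  cdmul u (cdmul (i n) a) = - cdmul (i n) (cdmul u a).
Proof.
move=> aC uC; apply: (can_inj (@cdconjK _)).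
rewrite cdconjN [LHS]cdconjM (cdconj_perp (cdi_perp aC)) !cdconjM cdconj_i.
rewrite !cdconj_perp //.
by rewrite !(cdmulNr, cdmulNl) !opprK cdi_mulA.
Qed.

Lemma cdinner_i n (x y : CD R n.+1) :
  cdinner (cdmul (i n) x) (cdmul (i n) y) = cdinner x y.
Proof. by rewrite cdinner_mull cdconj_i cdmulNl cdi_mulKl opprK. Qed.

(** * Imaginary elements, annihilators and orthogonality *)

(** Left multiplication by an imaginary element is skew-adjoint. *)
Lemma cdinner_imag_mul n (a x : CD R n) : cdconj a = - a ->
  cdinner x (cdmul a x) = 0.
Proof.
move=> aN; have := cdinner_mull a x x.
by rewrite aN cdmulNl cdinnerNr cdinnerC => xN; lra.
Qed.

(** The kernel of a skew-adjoint map is orthogonal to its image. *)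
Lemma Ann_imag_orth n (a x y : CD R n) : cdconj a = - a ->
  x \in Ann a -> cdinner x (cdmul a y) = 0.
Proof.
rewrite memv_Ann => aN /eqP ax0; apply/eqP; rewrite -oppr_eq0 -cdinnerNr.
by rewrite -cdmulNl -aN -cdinner_mull ax0 cdinner0l.
Qed.

Lemma cdorth_gen_mul n (S : seq (CD R n)) (b x : CD R n) : cdconj b = - b ->
  b \in cdgen S -> x \in cdorth (cdgen S) -> cdmul b x \in cdorth (cdgen S).
Proof.
move=> bN Sb /memv_cdorth xS; apply/memv_cdorth => u Su.
by rewrite cdinner_mull bN cdmulNl cdinnerNr xS ?oppr0 ?cdgen_mul.
Qed.

Lemma span_mul n (s : seq (CD R n)) (U : {vspace CD R n}) :
  {in s &, forall x y, cdmul x y \in U} ->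
  {in <<s>>%VS &, forall x y, cdmul x y \in U}.
Proof.
move=> sU; have sU1 x : x \in s -> (<<s>> <= linfun (cdmul x) @^-1: U)%VS.
  by move=> sx; apply/span_subvP => y sy; rewrite -memv_preim lfunE sU.
move=> x y sx sy; rewrite -[cdmul x y](lfunE (cdrmul y)) memv_preim.
apply: subvP sx; apply/span_subvP => z sz; rewrite -memv_preim lfunE.
by have /subvP/(_ _ sy) := sU1 _ sz; rewrite -memv_preim lfunE.
Qed.

(** * The quaternion algebra generated by a and i_n *)

Section Quaternions.
Variables (n : nat) (a : CD R n.+1).
Hypothesis aC : a \in Cperp n.
Local Notation N := (cdinner a a).
Local Notation e := (cdone R n.+1).
Local Notation ii := (i n).
Local Notation ia := (cdmul (i n) a).

Let aN : cdconj a = - a. Proof. exact: cdconj_perp. Qed.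
Let iaC : ia \in Cperp n. Proof. exact: cdi_perp. Qed.

Lemma cdmul_sqr : cdmul a a = - (N *: e).
Proof. by rewrite -cdmul_conj aN cdmulNr opprK. Qed.

Lemma cdmul_a_ia : cdmul a ia = N *: ii.
Proof. by rewrite cdi_mulCA // cdmul_sqr cdmulNr cdmulZr opprK cdmul1r. Qed.

Lemma cdmul_ia_a : cdmul ia a = - (N *: ii).
Proof. by rewrite cdi_mulA // cdmul_sqr cdmulNl cdmulZl cdmul1l. Qed.

Lemma cdmul_ia_i : cdmul ia ii = a.
Proof. by rewrite cdi_anticomm // cdi_mulKl opprK. Qed.

End Quaternions.

Lemma cdmul_sqr_ia n (a : CD R n.+1) : a \in Cperp n ->
  cdmul (cdmul (i n) a) (cdmul (i n) a) = - (cdinner a a *: cdone R n.+1).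
Proof. by move=> aC; rewrite cdmul_sqr ?cdi_perp // cdinner_i. Qed.

(** The multiplication table of [1, a, i, i a], as a rewriting rule.  The only
    entry without a rule is [i a], which is itself in the basis. *)
Definition cdHtable n (a : CD R n.+1) (aC : a \in Cperp n) :=
  (cdmul1l, cdmul1r, cdii, cdmul_sqr aC, cdmul_a_ia aC, cdmul_ia_a aC,
   cdmul_ia_i aC, cdmul_sqr_ia aC, cdi_mulKl, cdi_anticomm aC).

(** By the multiplication table, the span is closed under products. *)
Lemma cdH_span n (a : CD R n.+1) : a \in Cperp n ->
  cdH a = <<[:: cdone R n.+1; a; i n; cdmul (i n) a]>>%VS.
Proof.
move=> aC; set s := [:: _; _; _; _].
apply/eqP; rewrite eqEsubv; apply/andP; split.
  have [s1 [sa [si sia]]] : cdone R n.+1 \in <<s>>%VS /\ a \in <<s>>%VS /\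
      i n \in <<s>>%VS /\ cdmul (i n) a \in <<s>>%VS.
    by do !split; rewrite memv_span // !inE eqxx ?orbT.
  apply: cdgen_min => // [x|]; first by rewrite !inE => /orP[]/eqP ->.
  apply: span_mul => x y; rewrite !inE.
  move=> /or4P[] /eqP -> /or4P[] /eqP ->;
    by rewrite ?(cdHtable aC) ?memvN ?memvZ.
have [Ha Hi] : a \in cdH a /\ i n \in cdH a.
  by split; rewrite cdgen_sub // !inE eqxx ?orbT.
apply/span_subvP => x; rewrite !inE.
by case/or4P => /eqP ->; rewrite ?cdgen_mul // cdgen_one.
Qed.

Lemma dim_cdH n (a : CD R n.+1) : a != 0 -> a \in Cperp n -> \dim (cdH a) = 4%N.
Proof.
move=> a0 aC; have iaC := cdi_perp aC; rewrite cdH_span //.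
apply/eqP; apply: free_cdorthogonal; last first.
  have orthC x : x \in Cperp n ->
      (cdinner (cdone R n.+1) x == 0) && (cdinner (i n) x == 0).
    rewrite ![cdinner _ x]cdinnerC => /memv_cdorth_span xC.
    by rewrite !xC ?inE ?eqxx ?orbT.
  rewrite /=; have /andP[-> ai] := orthC _ aC.
  have /andP[-> iai] := orthC _ iaC.
  rewrite [cdinner a (i n)]cdinnerC ai iai !andbT.
  rewrite cdinner_imag_mul ?cdconj_i // eqxx andbT.
  by rewrite cdinnerC cdinner1r cdre_pair linear0 eqxx.
(* The three other basis vectors are non-zero, being left factors of [a] or of
   [- a]. *)
have factor_neq0 (x y : CD R n.+1) : cdmul x y != 0 -> 0 != x.
  by apply: contraNneq => <-; rewrite cdmul0l.
have e_neq0 : 0 != cdone R n.+1.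
  by apply: (@factor_neq0 _ a); rewrite cdmul1l.
have i_neq0 : 0 != i n.
  by apply: (@factor_neq0 _ (cdmul (i n) a)); rewrite cdi_mulKl oppr_eq0.
have ia_neq0 : 0 != cdmul (i n) a.
  by apply: (@factor_neq0 _ (i n)); rewrite cdmul_ia_i.
by rewrite !inE !negb_or e_neq0 i_neq0 ia_neq0 eq_sym a0.
Qed.

(** * The annihilator of (a, i_n a) *)

(** [Ann a] is orthogonal to [a 1], [a a], [a i] and [a (i a)], which up to
    non-zero factors are the four basis vectors of [H]. *)
Lemma Ann_sub_cdH_orth n (a : CD R n.+1) : a != 0 -> a \in Cperp n ->
  (Ann a <= cdorth (cdH a))%VS.
Proof.
move=> a0 aC; apply/subvP => x ax0.
have xa := Ann_imag_orth _ (cdconj_perp aC) ax0.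
have N0 : cdinner a a != 0 by rewrite cdinner_eq0.
rewrite cdH_span //; apply/memv_cdorth_span => u.
have x1 := xa (cdone _ _); have xaa := xa a.
have xi := xa (i n); have xia := xa (cdmul (i n) a).
move: x1 xaa xi xia; rewrite !(cdHtable aC) !(cdinnerNr, cdinnerZr).
move=> x1 xaa xi xia.
rewrite !inE => /or4P[]/eqP ->;
  first [lra | apply: (mulfI N0); lra].
Qed.

(** With [alpha = (a, i a)] and [N = <a, a>], the eight products of [alpha] with
    [(h, 0)] and [(0, h)], for [h] in the basis of [H], form four pairs such as
    [alpha (1, 0) = (a, i a)] and [alpha (0, i) = (- a, i a)], or
    [alpha (a, 0) = (- N, N i)] and [alpha (0, i a) = (- N, - N i)]; the sum and
    the difference of each pair isolate two vectors of the form [(h, 0)] or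
    [(0, h)].  So orthogonality to the products is orthogonality to [H * H]. *)
Lemma Ann_pair_i_orth n (a x y : CD R n.+1) : a != 0 -> a \in Cperp n ->
  cdpair x y \in Ann (cdpair a (cdmul (i n) a)) ->
  x \in cdorth (cdH a) /\ y \in cdorth (cdH a).
Proof.
move=> a0 aC alpha0; have iaC := cdi_perp aC.
have alphaN : cdconj (cdpair a (cdmul (i n) a)) = - cdpair a (cdmul (i n) a).
  by rewrite cdconj_pair cdconj_perp.
have xy p q : cdinner x (cdmul a p - cdmul (cdconj q) (cdmul (i n) a)) +
               cdinner y (cdmul q a + cdmul (cdmul (i n) a) (cdconj p)) = 0.
  have := Ann_imag_orth (cdpair p q) alphaN alpha0.
  by rewrite cdmul_pair cdinner_pair.
have N0 : cdinner a a != 0 by rewrite cdinner_eq0.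
move: (xy (cdone _ _) 0) (xy a 0) (xy (i n) 0) (xy (cdmul (i n) a) 0)
      (xy 0 (cdone _ _)) (xy 0 a) (xy 0 (i n)) (xy 0 (cdmul (i n) a)).
rewrite !cdconj_i !cdconj1 !(cdconj_perp aC) !(cdconj_perp iaC).
rewrite ![cdconj 0]linear0 !(cdmul0r, cdmul0l, cdmulNr, cdmulNl, cdHtable aC).
rewrite !(subr0, sub0r, addr0, add0r, opprK).
rewrite !(cdinnerNr, cdinnerZr).
move=> *; split; rewrite cdH_span //; apply/memv_cdorth_span => u;
  rewrite !inE => /or4P[]/eqP ->;
  first [lra | apply: (mulfI N0); lra].
Qed.

(** All four products in either equation are [a u] or [i (a u)] up to sign:
    since [a u] is again orthogonal to [1] and [i], we have [u a = - a u] and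
    [(a u) i = - i (a u)].  The signs add up in the first equation and cancel in
    the second. *)
Lemma cdmul_pair_i_graph n (a u : CD R n.+1) :
  a \in Cperp n -> u \in cdorth (cdH a) ->
  cdmul (cdpair a (cdmul (i n) a)) (cdpair u (cdmul (i n) u)) =
    2 *: cdpair (cdmul a u) (cdmul (i n) (cdmul a u)) /\
  cdmul (cdpair a (cdmul (i n) a)) (cdpair u (- cdmul (i n) u)) = 0.
Proof.
move=> aC uH; have sCH : (cdorth (cdH a) <= Cperp n)%VS.
  apply/cdorthS/span_subvP => x; rewrite !inE => /orP[]/eqP ->.
    exact: cdgen_one.
  by rewrite cdgen_sub // !inE eqxx orbT.
have uC := subvP sCH _ uH; have iuC := cdi_perp uC.
have auC : cdmul a u \in Cperp n.
  apply: (subvP sCH); apply: cdorth_gen_mul => //; first exact: cdconj_perp.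
  by rewrite cdgen_sub ?mem_head.
have ua : cdmul u a = - cdmul a u.
  rewrite -(cdconj_perp auC) cdconjM.
  by rewrite (cdconj_perp aC) (cdconj_perp uC) cdmulNl cdmulNr opprK.
have ia_u : cdmul (cdmul (i n) a) u = - cdmul (i n) (cdmul a u).
  by rewrite cdi_mulA // cdi_anticomm.
have iu_a : cdmul (cdmul (i n) u) a = cdmul (i n) (cdmul a u).
  by rewrite cdi_mulA // ua cdmulNl cdi_anticomm // opprK.
have iu_ia : cdmul (cdmul (i n) u) (cdmul (i n) a) = cdmul a u.
  by rewrite cdi_mulCA // iu_a cdi_mulKl opprK.
split; rewrite cdmul_pair ?cdconjN (cdconj_perp uC) (cdconj_perp iuC);
  rewrite !(cdmulNl, cdmulNr, opprK) ia_u iu_a iu_ia ?opprK.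
  by rewrite scaler_nat mulr2n.
by rewrite subrr addNr.
Qed.

Lemma Ann_pair_i n (a : CD R n.+1) : a != 0 -> a \in Cperp n ->
  Ann (cdpair a (cdmul (i n) a)) =
    (graphv (cdlmul (i n)) (Ann a) +
     graphv (- cdlmul (i n)) (cdorth (cdH a)))%VS.
Proof.
move=> a0 aC; apply/eqP; rewrite eqEsubv subv_add.
apply/and3P; split; apply/subvP.
- elim/cdpairP => x y xy0; have [xH yH] := Ann_pair_i_orth a0 aC xy0.
  have iH : i n \in cdH a by rewrite cdgen_sub // !inE eqxx orbT.
  (* [u] and [v] solve [u + v = x] and [i u - i v = y]. *)
  pose iy := cdmul (i n) y.
  have iyH : iy \in cdorth (cdH a) by rewrite cdorth_gen_mul ?cdconj_i.
  pose u := 2^-1 *: (x - iy); pose v := 2^-1 *: (x + iy).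
  have uH : u \in cdorth (cdH a) by rewrite memvZ ?memvB.
  have vH : v \in cdorth (cdH a) by rewrite memvZ ?memvD.
  have uv : x = u + v.
    rewrite -scalerDr addrACA addNr addr0 -mulr2n -scaler_nat scalerA.
    by rewrite mulVf ?scale1r ?pnatr_eq0.
  have iuv : y = cdmul (i n) u - cdmul (i n) v.
    have -> : cdmul (i n) u - cdmul (i n) v = cdmul (i n) (u - v).
      by rewrite linearB.
    rewrite -scalerBr opprD addrACA subrr add0r -opprD -mulr2n.
    rewrite -scaler_nat scalerN scalerA mulVf ?scale1r ?pnatr_eq0 //.
    by rewrite cdmulNr cdi_mulKl opprK.
  have xyE : cdpair x y = cdpair u (cdmul (i n) u) + cdpair v (- cdmul (i n) v).
    by rewrite cdpairD -uv -iuv.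
  rewrite xyE; apply: memv_add; apply/memv_graphv.
    exists u; last by rewrite cdlmulE.
    move: xy0; rewrite !memv_Ann xyE linearD /= (cdmul_pair_i_graph aC uH).1.
    rewrite (cdmul_pair_i_graph aC vH).2 addr0 scaler_eq0 pnatr_eq0 /=.
    by move/eqP/(congr1 fst) => /= ->.
  by exists v; rewrite // opp_lfunE cdlmulE.
- move=> _ /memv_graphv[x ax0 ->].
  have xH := subvP (Ann_sub_cdH_orth a0 aC) _ ax0.
  rewrite memv_Ann cdlmulE (cdmul_pair_i_graph aC xH).1.
  by move: ax0; rewrite memv_Ann => /eqP ->; rewrite cdmul0r scaler0.
- move=> _ /memv_graphv[x xH ->].
  by rewrite memv_Ann opp_lfunE cdlmulE (cdmul_pair_i_graph aC xH).2.
Qed.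

(** * The other sign, and dimensions *)

Definition cdflip n (x : CD R n.+1) : CD R n.+1 := cdpair x.1 (- x.2).

Lemma cdflip_is_linear n : linear (@cdflip n).
Proof.
move=> k; elim/cdpairP => x1 x2; elim/cdpairP => y1 y2.
by rewrite /cdflip /= opprD -scalerN.
Qed.
HB.instance Definition _ n :=
  GRing.isLinear.Build R (CD R n.+1) (CD R n.+1) _ (@cdflip n)
    (@cdflip_is_linear n).

Lemma cdflipK n : involutive (@cdflip n).
Proof. by elim/cdpairP => x1 x2; rewrite /cdflip /= opprK. Qed.

(** Each half of a product involves the second components of the factors with
    the same parity: an even number of them in the first half, an odd number in
    the second. *)
Lemma cdflipM n (x y : CD R n.+1) :
  cdflip (cdmul x y) = cdmul (cdflip x) (cdflip y).
Proof.
elim/cdpairP: x => x1 x2; elim/cdpairP: y => y1 y2.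
rewrite /cdflip !cdmul_pair /= cdconjN cdmulNl cdmulNr opprK.
by rewrite !cdmulNl opprD.
Qed.

Lemma Ann_flip n (x : CD R n.+1) :
  Ann (cdflip x) = (linfun (@cdflip n) @: Ann x)%VS.
Proof.
apply/vspaceP => y; apply/idP/memv_imgP => [xy0 | [z xz0 ->]].
  exists (cdflip y); last by rewrite lfunE /= cdflipK.
  move: xy0; rewrite !memv_Ann -(inj_eq (can_inj (@cdflipK n))).
  by rewrite cdflipM cdflipK linear0.
move: xz0; rewrite !memv_Ann lfunE /= -cdflipM => /eqP ->.
by rewrite linear0.
Qed.

Lemma graphv_flip n (f : 'End(CD R n)) U :
  graphv (- f) U = (linfun (@cdflip n) @: graphv f U)%VS.
Proof.
rewrite /graphv -limg_comp; congr (_ @: _)%VS; apply/lfunP => x.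
by rewrite comp_lfunE !lfunE -[LHS]/(cdpair x ((- f) x)) opp_lfunE.
Qed.

Lemma dim_graphv n (f : 'End(CD R n)) U : \dim (graphv f U) = \dim U.
Proof.
apply: limg_dim_eq; apply/eqP; rewrite -subv0; apply/subvP => x.
rewrite memv_cap memv_ker lfunE memv0 /= => /andP[_ /eqP].
by move/(congr1 fst) => /= ->.
Qed.

Lemma directv_graphvN n (f g : 'End(CD R n)) U V :
  g = - f -> lker f = 0%VS -> directv (graphv f U + graphv g V).
Proof.
move=> -> kerf; apply/directv_addP/eqP; rewrite -subv0; apply/subvP => z.
rewrite memv_cap => /andP[/memv_graphv[x _ ->] /memv_graphv[y _]].
rewrite opp_lfunE => -[<- /eqP]; rewrite -addr_eq0 -mulr2n -scaler_nat.
rewrite scaler_eq0 pnatr_eq0 /= -memv_ker kerf memv0 => /eqP ->.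
by rewrite linear0 mem0v.
Qed.

Lemma lker_cdi n : lker (cdlmul (i n)) = 0%VS.
Proof.
apply/eqP; rewrite -subv0; apply/subvP => x.
rewrite memv_ker cdlmulE => /eqP ix0.
by rewrite memv0 -oppr_eq0 -cdi_mulKl ix0 cdmul0r.
Qed.

End CayleyDickson.

Theorem theorem10p2 (R : realType) (n : nat) (hn : (1 <= n)%N) (a : CD R n)
    (a_neq0 : a != 0) (a_orth : a \in cdorth (cdcomplex R n)) :
  [/\ Ann (cdpair a (cdmul (cdi R n) a)) =
        (graphv (cdlmul (cdi R n)) (Ann a) +
         graphv (- cdlmul (cdi R n)) (cdorth (cdH a)))%VS
      /\ directv (graphv (cdlmul (cdi R n)) (Ann a) +
                  graphv (- cdlmul (cdi R n)) (cdorth (cdH a))),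
      Ann (cdpair a (- cdmul (cdi R n) a)) =
        (graphv (- cdlmul (cdi R n)) (Ann a) +
         graphv (cdlmul (cdi R n)) (cdorth (cdH a)))%VS
      /\ directv (graphv (- cdlmul (cdi R n)) (Ann a) +
                  graphv (cdlmul (cdi R n)) (cdorth (cdH a))),
      (\dim (Ann (cdpair a (cdmul (cdi R n) a))))%:Z =
        2 ^+ n - 4 + (\dim (Ann a))%:Z
    & (\dim (Ann (cdpair a (- cdmul (cdi R n) a))))%:Z =
        2 ^+ n - 4 + (\dim (Ann a))%:Z].
Proof.
case: n hn a a_neq0 a_orth => [//|n] _ a a0 aC.
set L := cdlmul _.
have AnnE := Ann_pair_i a0 aC.
have AnnNE : Ann (cdpair a (- cdmul (cdi R n.+1) a)) =
    (graphv (- L) (Ann a) + graphv L (cdorth (cdH a)))%VS.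
  rewrite -[cdpair _ _]/(cdflip (cdpair a (cdmul (cdi R n.+1) a))) Ann_flip.
  by rewrite AnnE limgD -!graphv_flip opprK.
have kerL : lker L = 0%VS := lker_cdi R n.
have dirP : directv (graphv L (Ann a) + graphv (- L) (cdorth (cdH a))).
  exact: directv_graphvN.
have dirN : directv (graphv (- L) (Ann a) + graphv L (cdorth (cdH a))).
  apply: directv_graphvN; first by rewrite opprK.
  by rewrite -kerL; apply/vspaceP => x; rewrite !memv_ker opp_lfunE oppr_eq0.
have dimH : (\dim (cdorth (cdH a)))%:Z = 2 ^+ n.+1 - 4 :> int.
  have := dim_cdorth (cdH a); rewrite dim_cdH // => /(congr1 Posz).
  by rewrite PoszD -[RHS]natz natrX => <-; rewrite addrC addKr.
have dimD (d : nat) : d = (\dim (Ann a) + \dim (cdorth (cdH a)))%N ->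
    d%:Z = 2 ^+ n.+1 - 4 + (\dim (Ann a))%:Z :> int.
  by move=> ->; rewrite PoszD dimH addrC.
split; [by [] | by [] | apply: dimD | apply: dimD].
  by rewrite AnnE dimv_disjoint_sum ?dim_graphv //; apply/directv_addP.
by rewrite AnnNE dimv_disjoint_sum ?dim_graphv //; apply/directv_addP.
Qed.
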